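(* For any type $\sigma$ and any sequence of blocks $\delta=(d_1^{m_1},\ldots,d_s^{m_s})$, \[ p_{\sigma}^{\otimes}H_{\delta}=\sum_{\tau} \left[\sum_{T\in\mathrm{ICRHT}(\tau,(\sigma;\delta))} \operatorname{wt}(T)\right] p_{\tau}^{\otimes}, \] where the outer sum is over types $\tau$ and $\mathrm{ICRHT}(\tau,(\sigma;\delta))$ is the set of increasing constant-row $H$-tableaux of shape $\tau$ and extended content $(\sigma;\delta)$.
   Context: An integer partition is a finite (possibly empty) weakly decreasing sequence of positive integers; $m_i(\lambda)$ is the number of parts of $\lambda$ equal to $i$, and $z_\lambda=\prod_{i\ge1}i^{m_i(\lambda)}m_i(\lambda)!$. A block is an ordered pair of positive integers written $d^m$ (degree $d$, multiplicity $m$). Blocks are ordered by $a^b\ge d^e$ iff $a>d$, or $a=d$ and $b\ge e$. A type is a finite (possibly empty) weakly decreasing sequence of blocks $\tau=(a_1^{b_1},\dots,a_t^{b_t})$; $\tau\Vdash n$ means $\sum_ia_ib_i=n$. For $k\ge1$, $\tau|_k$ denotes the integer partition formed by the multiplicities of the blocks of $\tau$ of degree $k$; the type $\tau$ is determined by $(\tau|_k)_{k\ge1}$. Put $z^\otimes_\tau=\prod_{k\ge1}z_{\tau|_k}$. The tensor diagram of $\tau$ is the sequence of partition diagrams $\mathrm{dg}(\tau|_1)\otimes\mathrm{dg}(\tau|_2)\otimes\cdots$; the $k$th component has rows (left-justified, longest at top) of lengths the parts of $\tau|_k$. Variables: $x_{k,j}$ for $k,j\ge 1$, with $\deg x_{k,j}=k$;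 $\mathbf{x}_{k*}=(x_{k,1},x_{k,2},\dots)$. The algebra $\mathsf{P\Lambda}$ of polysymmetric functions consists of the formal series over $\mathbb{Q}$ of bounded degree in all the $x_{k,j}$ that, for each fixed $k$, are unchanged by any permutation of the variables $\mathbf{x}_{k*}$. Define $p^{\otimes}_\tau=\prod_{k\ge1}p_{\tau|_k}(\mathbf{x}_{k*})$, where $p_\lambda$ is the power-sum symmetric function. $H_d$ is the sum of all distinct monomials of degree $d$ in the variables $x_{k,j}$ (with $\deg x_{k,j}=k$), $H_{d^m}$ is obtained from $H_d$ by replacing every variable $x_{k,j}$ by $x_{k,j}^m$, and $H_\delta=\prod_{i=1}^sH_{d_i^{m_i}}$. An increasing constant-row $H$-tableau (ICRHT) of shape $\tau$ and extended content $(\sigma;\delta)$, where $\delta=(d_1^{m_1},\dots,d_s^{m_s})$, is a filling $T$ of the cells of the tensor diagram of $\tau$ with integers $0,1,\dots,s$ such that: (i) each row of each component is constant; (ii) the cells containing $0$ form a sub-tensor diagram equal to that of $\sigma$, i.e., for each $k$ the multiset of lengths of the rows of component $k$ filled with $0$ is the multiset of parts of $\sigma|_k$; (iii) for $1\le i\le s$, the cells containing $i$ form a sub-tensor diagram equal to $\mathrm{dg}(m_i\rho^{(i)})$ for some type $\rho^{(i)}\Vdash d_i$, i.e., for each $k$ the multiset of lengths of the rows of component $k$ filled with $i$ is the multiset of parts of $\rho^{(i)}|_k$ each multiplied by $m_i$; (iv) for each $r,k$, the values in the rows of length $r$ in component $k$ weakly increase reading down the first column. The weight is $\operatorname{wt}(T)=\prod_{i=1}^s1/z^\otimes_{\rho^{(i)}}$.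 *)

(* Defs.v *)
From HB Require Import structures.
From mathcomp Require Import all_boot all_order all_algebra finmap.
From mathcomp Require Import boolp classical_sets functions cardinality fsbigop.
From mathcomp.multinomials Require Import monalg.

Set Implicit Arguments.
Unset Strict Implicit.
Unset Printing Implicit Defensive.

Import Order.TTheory GRing.Theory Num.Theory.

Local Open Scope classical_set_scope.
Local Open Scope ring_scope.

(** Indices are shifted by one: the pair (i, j) of natural numbers stands for
    the variable x_{i+1,j+1}, which has degree i+1. *)
Definition var : Type := (nat * nat)%type.
HB.instance Definition _ := Choice.on var.

Definition mon : Type := {cmonom var}.
HB.instance Definition _ := ConomialDef.on mon.

Definition monX (v : var) : mon := ucm v.

Definition wdeg (m : mon) : nat := (\sum_(v <- finsupp m) m v * v.1.+1)%N.

Record series := Series { coef :> mon -> rat }.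

HB.instance Definition _ := gen_eqMixin series.
HB.instance Definition _ := gen_choiceMixin series.

Lemma seriesP (f g : series) : (forall m, f m = g m) -> f = g.
Proof. by case: f g => [f] [g] /= /funext ->. Qed.

Definition sadd (f g : series) := Series (fun m => f m + g m).
Definition sopp (f : series) := Series (fun m => - f m).
Definition szero := Series (fun=> 0).
Definition sone := Series (fun m => (m == mone)%:R).
Definition sscale (a : rat) (f : series) := Series (fun m => a * f m).
Definition smul (f g : series) := Series (fun m =>
  \sum_(p \in [set p : mon * mon | mmul p.1 p.2 = m]) f p.1 * g p.2).

Lemma monP (m n : mon) : (forall v, m v = n v) -> m = n.
Proof. by move=> h; apply/eqP/cmP. Qed.

Lemma monM (m n : mon) v : mmul m n v = (m v + n v)%N.
Proof. exact: cmM. Qed.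

Lemma finite_divisors (m : mon) :
  finite_set [set d : mon | exists e, mmul d e = m].
Proof.
pose D := finsupp m.
pose N := (\sum_(v <- finsupp m) m v)%N.
pose h (g : {ffun D -> 'I_N.+1}) : mon :=
  mkcmonom [fsfun v : D => nat_of_ord (g v) | 0%N].
apply: (@sub_finite_set _ _ (h @` setT)); last exact/finite_image/finite_finset.
move=> d [e dem] /=.
have le v : (d v <= m v)%N by rewrite -dem monM leq_addr.
exists [ffun v : D => inord (d (fsval v))] => //; apply: monP => v.
rewrite /h cmE fsfun_ffun; case: insubP => [u uD uv|vD] /=.
  rewrite ffunE uv inordK// ltnS (leq_trans (le v))//.
  by rewrite /N (big_fsetD1 v)//= leq_addr.
move: (le v); have /eqP -> : m v == 0%N by rewrite cmE_eq0.
by rewrite leqn0 => /eqP.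
Qed.

Definition divs (m : mon) : {fset mon} :=
  fset_set [set d : mon | exists e, mmul d e = m].

Lemma divsP (m d : mon) : reflect (exists e, mmul d e = m) (d \in divs m).
Proof.
rewrite /divs in_fset_set; last exact: finite_divisors.
by apply: (iffP idP) => [/set_mem|/mem_set].
Qed.

Lemma divs_mull (a b : mon) : a \in divs (mmul a b).
Proof. by apply/divsP; exists b. Qed.

Lemma divs_mulr (a b : mon) : b \in divs (mmul a b).
Proof. by rewrite mulmC divs_mull. Qed.

Lemma divs_trans (a b c : mon) : a \in divs b -> b \in divs c -> a \in divs c.
Proof.
by move=> /divsP[e <-] /divsP[e' <-]; rewrite -mulmA divs_mull.
Qed.

Lemma coef_smul (f g : series) (m : mon) (D : {fset mon}) :
    {subset divs m <= D} ->
  smul f g m = \sum_(a <- D) \sum_(b <- D | mmul a b == m) f a * g b.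
Proof.
move=> sD.
pose r := [seq (a, b) | a <- enum_fset D, b <- enum_fset D].
have ur : uniq r by apply: allpairs_uniq => // -[? ?] [].
rewrite /= (fsbig_fwiden [seq p : mon * mon <- r | mmul p.1 p.2 == m]).
- rewrite big_filter big_mkcond big_allpairs; apply: eq_bigr => a _.
  by rewrite -big_mkcond.
- move=> [a b] /= abm; rewrite mem_filter /= abm eqxx /=.
  by apply/allpairsP; exists (a, b); split => //=; apply: sD;
    rewrite -abm ?divs_mull ?divs_mulr.
- exact: filter_uniq.
- by move=> p [] /=; rewrite mem_filter => /andP[/eqP].
Qed.

Lemma sum_mon_eq (D : {fset mon}) (c : mon) (F : mon -> rat) : c \in D ->
  \sum_(b <- D | c == b) F b = F c.
Proof.
move=> cD; rewrite big_mkcond (big_fsetD1 c)//= eqxx big_seq big1 ?addr0// => b.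
by rewrite !inE => /andP[/negbTE + _]; rewrite eq_sym => ->.
Qed.

Lemma saddA : associative sadd.
Proof. by move=> f g h; apply: seriesP => m /=; rewrite addrA. Qed.
Lemma saddC : commutative sadd.
Proof. by move=> f g; apply: seriesP => m /=; rewrite addrC. Qed.
Lemma sadd0 : left_id szero sadd.
Proof. by move=> f; apply: seriesP => m /=; rewrite add0r. Qed.
Lemma saddN : left_inverse szero sopp sadd.
Proof. by move=> f; apply: seriesP => m /=; rewrite addNr. Qed.

HB.instance Definition _ := GRing.isZmodule.Build series saddA saddC sadd0 saddN.

Lemma smulC : commutative smul.
Proof.
move=> f g; apply: seriesP => m.
rewrite !(@coef_smul _ _ m (divs m))// (exchange_big_dep xpredT)//=.
apply: eq_bigr => a _.
by apply: eq_big => b; [rewrite mulmC|rewrite mulrC].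
Qed.

Lemma smul1 : left_id sone smul.
Proof.
move=> f; apply: seriesP => m.
rewrite (@coef_smul _ _ m (divs m))//.
have oD : mone \in divs m by apply/divsP; exists m; rewrite mul1m.
rewrite (big_fsetD1 mone)//= [X in _ + X]big_seq [X in _ + X]big1.
  rewrite addr0 (eq_bigl (fun b => m == b)).
    rewrite sum_mon_eq ?eqxx ?mul1r//.
    by apply/divsP; exists mone; rewrite mulm1.
  by move=> b; rewrite mul1m eq_sym.
move=> a; rewrite !inE => /andP[/negbTE na _].
by rewrite big1 // => b _; rewrite na mul0r.
Qed.

Lemma smulDl : left_distributive smul sadd.
Proof.
move=> f g h; apply: seriesP => m.
change (smul (sadd f g) h m = smul f h m + smul g h m).
rewrite !(@coef_smul _ _ m (divs m))// -big_split/=.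
apply: eq_bigr => a _; rewrite -big_split/=.
by apply: eq_bigr => b _; rewrite mulrDl.
Qed.

Lemma smulA : associative smul.
Proof.
move=> f g h; apply: seriesP => m; pose D := divs m.
have sub a : a \in D -> {subset divs a <= D}.
  by move=> aD b bD; exact: divs_trans bD aD.
have L : smul f (smul g h) m = \sum_(a <- D) \sum_(c <- D) \sum_(d <- D)
    (if mmul (mmul a c) d == m then f a * (g c * h d) else 0).
  rewrite (@coef_smul _ _ m D)//; apply: eq_bigr => a _.
  transitivity (\sum_(b <- D | mmul a b == m) \sum_(c <- D) \sum_(d <- D)
      (if mmul c d == b then f a * (g c * h d) else 0)).
    rewrite big_seq_cond [RHS]big_seq_cond; apply: eq_bigr => b /andP[bD _].
    rewrite (@coef_smul _ _ b D); last exact: sub.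
    rewrite mulr_sumr; apply: eq_bigr => c _.
    by rewrite mulr_sumr big_mkcond.
  rewrite exchange_big; apply: eq_bigr => c _.
  rewrite exchange_big; apply: eq_bigr => d _.
  have [E|nE] := eqVneq (mmul (mmul a c) d) m.
    rewrite -big_mkcondr/= (eq_bigl (fun b => mmul c d == b)).
      by rewrite sum_mon_eq// /D -E -mulmA divs_mulr.
    move=> b /=; case: (eqVneq (mmul c d) b) => [<-|]; last by rewrite andbF.
    by rewrite mulmA E eqxx.
  rewrite big1// => b /eqP abm; case: eqVneq => // cdb.
  by rewrite -mulmA cdb abm eqxx in nE.
have R : smul (smul f g) h m = \sum_(d <- D) \sum_(a <- D) \sum_(c <- D)
    (if mmul (mmul a c) d == m then f a * (g c * h d) else 0).
  rewrite smulC (@coef_smul _ _ m D)//; apply: eq_bigr => d _.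
  transitivity (\sum_(b <- D | mmul d b == m) \sum_(a <- D) \sum_(c <- D)
      (if mmul a c == b then f a * (g c * h d) else 0)).
    rewrite big_seq_cond [RHS]big_seq_cond; apply: eq_bigr => b /andP[bD _].
    rewrite (@coef_smul _ _ b D); last exact: sub.
    rewrite mulr_sumr; apply: eq_bigr => c _.
    rewrite mulr_sumr big_mkcond; apply: eq_bigr => e _.
    by rewrite mulrC mulrA.
  rewrite exchange_big; apply: eq_bigr => a _.
  rewrite exchange_big; apply: eq_bigr => c _.
  have [E|nE] := eqVneq (mmul (mmul a c) d) m.
    rewrite -big_mkcondr/= (eq_bigl (fun b => mmul a c == b)).
      by rewrite sum_mon_eq// /D -E divs_mull.
    move=> b /=; case: (eqVneq (mmul a c) b) => [<-|]; last by rewrite andbF.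
    by rewrite mulmC E eqxx.
  rewrite big1// => b /eqP abm; case: eqVneq => // cdb.
  by rewrite mulmC cdb abm eqxx in nE.
rewrite L R [RHS]exchange_big; apply: eq_bigr => a _.
by rewrite exchange_big.
Qed.

Lemma sone_neq0 : sone != 0.
Proof.
by apply/eqP => /(congr1 (fun f : series => f mone)) /= /eqP; rewrite eqxx.
Qed.

HB.instance Definition _ := GRing.Zmodule_isComNzRing.Build series
  smulA smulC smul1 smulDl sone_neq0.

Lemma sscaleA a b f : sscale a (sscale b f) = sscale (a * b) f.
Proof. by apply: seriesP => m /=; rewrite mulrA. Qed.
Lemma sscale1 : left_id 1 sscale.
Proof. by move=> f; apply: seriesP => m /=; rewrite mul1r. Qed.
Lemma sscaleDr : right_distributive sscale +%R.
Proof. by move=> a f g; apply: seriesP => m /=; rewrite mulrDr. Qed.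
Lemma sscaleDl f : {morph sscale^~ f : a b / a + b}.
Proof. by move=> a b; apply: seriesP => m /=; rewrite mulrDl. Qed.

HB.instance Definition _ := GRing.Zmodule_isLmodule.Build rat series
  sscaleA sscale1 sscaleDr sscaleDl.

Lemma sscaleAl (a : rat) (f g : series) : a *: (f * g) = a *: f * g.
Proof.
apply: seriesP => m.
change (a * smul f g m = smul (sscale a f) g m).
rewrite !(@coef_smul _ _ m (divs m))// mulr_sumr; apply: eq_bigr => b _.
by rewrite mulr_sumr; apply: eq_bigr => c _; rewrite /= mulrA.
Qed.

HB.instance Definition _ := GRing.Lmodule_isLalgebra.Build rat series sscaleAl.

(** Permute the variables x_{k+1,1}, x_{k+1,2}, ... and fix all the others. *)
Definition permv (k : nat) (s : nat -> nat) (v : var) : var :=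
  (v.1, if v.1 == k then s v.2 else v.2).

Definition bounded_deg (f : series) : Prop :=
  exists N : nat, forall m, f m != 0 -> (wdeg m <= N)%N.

Definition row_symmetric (f : series) : Prop :=
  forall (k : nat) (s : nat -> nat), bijective s ->
  forall m m' : mon, (forall v, m' v = m (permv k s v)) -> f m' = f m.

Definition polysym_pred : {pred series} :=
  fun f => `[< bounded_deg f /\ row_symmetric f >].

Lemma polysymP (f : series) :
  reflect (bounded_deg f /\ row_symmetric f) (f \in polysym_pred).
Proof. exact: asboolP. Qed.

Lemma permv_bij k s : bijective s -> bijective (permv k s).
Proof.
by move=> [t st ts]; exists (permv k t) => -[i j]; rewrite /permv /=;
  case: eqVneq => // _; rewrite ?st ?ts.
Qed.

Lemma rename_ex (phi : var -> var) (m : mon) : bijective phi ->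
  exists m' : mon, forall v, m' v = m (phi v).
Proof.
move=> [psi pK Kp].
exists (mkcmonom [fsfun v in [fset psi w | w in finsupp m]%fset => m (phi v) | 0%N]).
move=> v; rewrite cmE fsfun_fun; case: ifPn => // vN.
apply/esym/eqP; rewrite cmE_eq0; apply: contra vN => vm.
by apply/imfsetP; exists (phi v) => //; rewrite pK.
Qed.

Lemma wdegE (m : mon) :
  wdeg m = (\big[addn/0%N]_(v \in [set: var]) (m v * v.1.+1)%N)%N.
Proof.
by rewrite (fsbigTE (finsupp m))// => v; rewrite -cmE_eq0 => /eqP ->.
Qed.

Lemma wdeg_sub (m : mon) (D : {fset var}) : (finsupp m `<=` D)%fset ->
  wdeg m = (\sum_(v <- D) m v * v.1.+1)%N.
Proof.
move=> sD; rewrite wdegE (fsbigTE D)// => v vD.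
have /eqP -> // : m v == 0%N.
by rewrite cmE_eq0; apply: contra vD => /(fsubsetP sD).
Qed.

Lemma wdegM (m n : mon) : wdeg (mmul m n) = (wdeg m + wdeg n)%N.
Proof.
pose D := (finsupp m `|` finsupp n)%fset.
rewrite (@wdeg_sub m D) ?fsubsetUl// (@wdeg_sub n D) ?fsubsetUr//.
rewrite (@wdeg_sub (mmul m n) D) ?mdomD// -big_split/=.
by apply: eq_bigr => v _; rewrite monM mulnDl.
Qed.

Lemma wdeg1 : wdeg mone = 0%N.
Proof. by rewrite /wdeg mdom1 big_seq_fset0. Qed.

Lemma expcmnS (m : mon) n : expcmn m n.+1 = mmul m (expcmn m n).
Proof. by case: n => [|n] //=; rewrite [RHS]mulm1. Qed.

Lemma expcmnE (m : mon) n v : (expcmn m n : mon) v = (n * m v)%N.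
Proof.
elim: n => [|n IH]; first by rewrite mul0n; exact: cm1.
by rewrite expcmnS monM IH mulSn.
Qed.

Lemma wdegX (m : mon) n : wdeg (expcmn m n) = (n * wdeg m)%N.
Proof.
elim: n => [|n IH]; first by rewrite mul0n; exact: wdeg1.
by rewrite expcmnS wdegM IH mulSn.
Qed.

Lemma wdeg_permv k s (m m' : mon) : bijective s ->
  (forall v, m' v = m (permv k s v)) -> wdeg m' = wdeg m.
Proof.
move=> sb mm'; rewrite !wdegE.
rewrite [RHS](reindex_fsbigT (permv k s)); last exact: permv_bij.
by apply: eq_fsbigr => v _; rewrite mm'.
Qed.

Lemma polysym_closed : GRing.subalg_closed polysym_pred.
Proof.
split.
- apply/polysymP; split.
    exists 0%N => m /=; case: (eqVneq m mone) => [->|_]; first by rewrite wdeg1.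
    by rewrite eqxx.
  move=> k s sb m m' mm' /=; congr (nat_of_bool _)%:R.
  have [psi pK Kp] := permv_bij k sb.
  apply/eqP/eqP => E; apply: monP => v.
    by have := mm' (psi v); rewrite Kp E !cm1.
  by rewrite mm' E !cm1.
- move=> a f g /polysymP[[N fN] fs] /polysymP[[M gM] gs].
  apply/polysymP; split.
    exists (maxn N M) => m /= h; rewrite leq_max.
    have [f0|/fN->//] := eqVneq (f m) 0.
    rewrite gM ?orbT//; apply: contraNneq h => g0.
    by rewrite f0 g0 mulr0 addr0.
  move=> k s sb m m' mm' /=.
  by rewrite (fs _ _ sb _ _ mm') (gs _ _ sb _ _ mm').
- move=> f g /polysymP[[N fN] fs] /polysymP[[M gM] gs].
  apply/polysymP; split.
    exists (N + M)%N => m /=.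
    move/(@fsbigN1 _ _ _ _ _ _ (fun _ : unit => fun p : mon * mon => _) tt).
    move=> [[a b] /= <-]; rewrite mulf_eq0 negb_or => /andP[/fN h1 /gM h2].
    by rewrite wdegM leq_add.
  move=> k s sb m m' mm' /=.
  have pb := permv_bij k sb.
  have [h hE] := choice (fun m : mon => @rename_ex _ m pb).
  have [psi pK Kp] := pb.
  rewrite (reindex_fsbig (fun p => (h p.1, h p.2)) [set p | mmul p.1 p.2 = m]).
    apply: eq_fsbigr => -[a b] _ /=.
    by rewrite (fs _ _ sb _ _ (hE a)) (gs _ _ sb _ _ (hE b)).
  split.
  + by move=> [a b] /= abm; apply: monP => v; rewrite mm' -abm !monM !hE.
  + have hI : injective h.
      by move=> a b hab; apply: monP => v; rewrite -(Kp v) -!hE hab.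
    by move=> [a b] [c d] _ _ /= [/hI -> /hI ->].
  + have hS (a : mon) : exists b, h b = a.
      have [b bE] := @rename_ex psi a (Bijective Kp pK).
      by exists b; apply: monP => v; rewrite hE bE pK.
    move=> [a b] /= abm; have [a' a'E] := hS a; have [b' b'E] := hS b.
    exists (a', b') => /=; last by rewrite a'E b'E.
    apply: monP => v; rewrite -(Kp v) -mm' -abm -a'E -b'E.
    by rewrite !monM !hE.
Qed.

HB.instance Definition _ :=
  GRing.isSubalgClosed.Build rat series polysym_pred polysym_closed.

Record polysym := PolySym { pser :> series; _ : pser \in polysym_pred }.

HB.instance Definition _ := [isSub for pser].
HB.instance Definition _ := [Choice of polysym by <:].
HB.instance Definition _ := [SubChoice_isSubComNzRing of polysym by <:].
HB.instance Definition _ := [SubZmodule_isSubLmodule of polysym by <:].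
HB.instance Definition _ := [SubNzRing_SubLmodule_isSubLalgebra of polysym by <:].

(** p_r(x_{k*}) for k = i+1. *)
Definition psum_series (i r : nat) : series :=
  Series (fun m => `[< exists j, m = expcmn (monX (i, j)) r >]%:R).

(** H_d: every monomial of degree [d] has coefficient 1. *)
Definition H_series (d : nat) : series := Series (fun m => (wdeg m == d)%:R).

(** Replace every variable x_{k,j} by x_{k,j}^n in a series. For n > 0 a
    monomial M has at most one n-th root N, so the sum has at most one term. *)
Definition subst_pow (n : nat) (f : series) : series :=
  Series (fun M => \sum_(N \in [set N : mon | expcmn N n = M]) f N).

Lemma psum_polysym i r : psum_series i r \in polysym_pred.
Proof.
apply/polysymP; split.
  exists (r * i.+1)%N => m /=; case: asboolP => [[j ->] _|]; last first.
    by rewrite eqxx.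
  by rewrite wdegX /wdeg mdomU big_seq_fset1 cmUU mul1n.
move=> k s sb m m' mm' /=; have [t st ts] := sb.
congr (nat_of_bool _)%:R; apply/asboolP/asboolP => -[j E].
  exists (permv k s (i, j)).2; apply: monP => v.
  have pb := permv_bij k sb; have [psi pK Kp] := pb.
  rewrite -(Kp v) -mm' E !expcmnE !cmU; congr (_ * nat_of_bool _)%N.
  exact/esym/(inj_eq (bij_inj pb) (i, j)).
exists (permv k t (i, j)).2; apply: monP => v.
rewrite mm' E !expcmnE !cmU; congr (_ * nat_of_bool _)%N.
have pb : bijective (permv k t) by apply: permv_bij; exists s.
rewrite -[in LHS](inj_eq (bij_inj pb)) /permv /=; case: v => a b /=.
by case: (eqVneq a k) => [|_] //=; rewrite st.
Qed.

Lemma H_polysym d : H_series d \in polysym_pred.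
Proof.
apply/polysymP; split.
  by exists d => m /=; case: (eqVneq (wdeg m) d) => [->|]; rewrite ?eqxx.
by move=> k s sb m m' mm' /=; rewrite (wdeg_permv sb mm').
Qed.

Lemma subst_pow_polysym n f :
  f \in polysym_pred -> subst_pow n f \in polysym_pred.
Proof.
move=> /polysymP[[N fN] fs]; apply/polysymP; split.
  exists (n * N)%N => M /=.
  move/(@fsbigN1 _ _ _ _ _ _ (fun _ : unit => fun p : mon => _) tt).
  by move=> [a /= <-] /fN aN; rewrite wdegX leq_mul2l aN orbT.
move=> k s sb m m' mm' /=.
have pb := permv_bij k sb.
have [h hE] := choice (fun m : mon => @rename_ex _ m pb).
have [psi pK Kp] := pb.
rewrite (reindex_fsbig h [set p | expcmn p n = m]).
  by apply: eq_fsbigr => a _ /=; rewrite (fs _ _ sb _ _ (hE a)).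
split.
- by move=> a /= am; apply: monP => v; rewrite mm' -am !expcmnE !hE.
- by move=> a b _ _ hab; apply: monP => v; rewrite -(Kp v) -!hE hab.
- move=> a /= am; have [b bE] := @rename_ex psi a (Bijective Kp pK).
  have ba : h b = a by apply: monP => v; rewrite hE bE pK.
  exists b => //=; apply: monP => v.
  by rewrite -(Kp v) -mm' -am -ba !expcmnE !hE.
Qed.

Definition psum (i r : nat) : polysym := PolySym (psum_polysym i r).

(** H_{d^m} for the block [b] = d^m. *)
Definition Hblock (b : nat * nat) : polysym :=
  PolySym (subst_pow_polysym b.2 (H_polysym b.1)).

Definition Hprod (delta : seq (nat * nat)) : polysym :=
  \prod_(b <- delta) Hblock b.

(** The pair (d, m) is the block d^m. *)
Definition is_block (b : nat * nat) : bool := (0 < b.1)%N && (0 < b.2)%N.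

Definition block_ge (a d : nat * nat) : bool :=
  (d.1 < a.1)%N || (a.1 == d.1) && (d.2 <= a.2)%N.

Record btype := BType {
  blocks :> seq (nat * nat);
  _ : all is_block blocks && sorted block_ge blocks }.

HB.instance Definition _ := [isSub for blocks].
HB.instance Definition _ := [Countable of btype by <:].

Definition empty_type : btype := @BType [::] isT.

Definition tsize (tau : btype) : nat := (\sum_(b <- tau) b.1 * b.2)%N.

(** The integer partition tau|_k. *)
Definition restr (tau : btype) (k : nat) : seq nat :=
  [seq b.2 | b <- tau & b.1 == k].

Definition zpart (la : seq nat) : nat :=
  (\prod_(1 <= i < (sumn la).+1) (i ^ count_mem i la * (count_mem i la)`!))%N.

(** In the next two products over k >= 1 the factors with k > tsize tau are
    trivial, since tau|_k is then empty; the index i stands for k = i+1. *)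
Definition ztensor (tau : btype) : nat :=
  (\prod_(i < tsize tau) zpart (restr tau i.+1))%N.

Definition ptensor (tau : btype) : polysym :=
  \prod_(i < tsize tau) \prod_(r <- restr tau i.+1) psum i r.

(** Cells are triples (component, row, column); components are numbered from 1,
    rows (top to bottom) and columns from 0. *)
Definition rowlen (tau : btype) (k r : nat) : nat := nth 0%N (restr tau k) r.

Definition dg (tau : btype) : seq (nat * nat * nat) :=
  [seq (kr, c) |
    kr <- [seq (k, r) | k <- iota 1 (tsize tau), r <- iota 0 (size (restr tau k))],
    c <- iota 0 (rowlen tau kr.1 kr.2)].

Definition cell (tau : btype) : finType := seq_sub (dg tau).

Section Tableaux.
Context (tau : btype).

Definition ccomp (c : cell tau) : nat := (val c).1.1.
Definition crow (c : cell tau) : nat := (val c).1.2.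
Definition ccol (c : cell tau) : nat := (val c).2.

Definition filling (s : nat) : finType := {ffun cell tau -> 'I_s.+1}.

(** The lengths of the rows of component [k] filled with [i]. *)
Definition filled_rows (s : nat) (T : filling s) (i k : nat) : seq nat :=
  [seq rowlen tau k r | r <- iota 0 (size (restr tau k)) &
    [forall c : cell tau, (ccomp c == k) && (crow c == r) ==> (T c == i :> nat)]].

(** [rho] is the type rho^(i+1): the cells of T containing i+1 form the tensor
    diagram of m rho, where d^m is the block of [delta] at position i
    (counting from 0) and rho is a type of d. *)
Definition is_rho (delta : seq (nat * nat)) (T : filling (size delta))
    (i : nat) (rho : btype) : Prop :=
  let: (d, m) := nth (0%N, 0%N) delta i in
  tsize rho = d /\
  forall k, perm_eq (filled_rows T i.+1 k) [seq (m * b)%N | b <- restr rho k].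

Definition ICRHT (sigma : btype) (delta : seq (nat * nat))
    (T : filling (size delta)) : Prop :=
  [/\ forall c c' : cell tau, ccomp c = ccomp c' -> crow c = crow c' -> T c = T c',
      forall k, perm_eq (filled_rows T 0 k) (restr sigma k),
      forall i, (i < size delta)%N -> exists rho, is_rho T i rho
    & forall c c' : cell tau, ccomp c = ccomp c' -> ccol c = 0%N -> ccol c' = 0%N ->
        rowlen tau (ccomp c) (crow c) = rowlen tau (ccomp c') (crow c') ->
        (crow c <= crow c')%N -> (T c <= T c')%N].

(** For T in ICRHT and m_i > 0 the type rho^(i) is determined by T, so that
    [xget] selects it. *)
Definition wt (delta : seq (nat * nat)) (T : filling (size delta)) : rat :=
  \prod_(i < size delta) ((ztensor (xget empty_type [set rho | is_rho T i rho]))%:R)^-1.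

End Tableaux.

(* Main.v *)
Require Import Defs.
From mathcomp Require Import all_boot all_order all_algebra finmap.
From mathcomp Require Import boolp classical_sets functions cardinality fsbigop.
From mathcomp.multinomials Require Import monalg.
From mathcomp Require Import zify.

(** The complete functions have power-sum expansions
      H_{d^n} = sum over the types rho of d of (z_rho)^-1 p_{n rho},
    where n rho has the multiplicities of rho multiplied by n.  Both sides X_d
    satisfy the same recursion
      d X_d = sum over the blocks k^r with k r <= d of k p_{k^{n r}} X_{d - k r},
    with X_0 = 1, and in characteristic 0 this determines X_d.

    - For H ([Hblock_rec]), compare the coefficients of a monomial M.  Only
      n-th powers M = N^n with N of degree d matter; the right-hand side then
      counts, with weight k, the pairs of a variable x_{k,j} and an exponent
      r >= 1 such that x_{k,j}^r divides N.  Their total weight is the degree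
      of N.
    - For the power sums ([psum_expansion_rec]), write the size d of a type rho
      as the sum of k r times the number of blocks of rho equal to k^r.
      Removing one block k^r from rho divides z_rho by r times that number.

    Multiplying the expansions of the factors of H_delta by p_sigma gives a
    sum over the tuples (rho^(1), ..., rho^(s)) of types of d_1, ..., d_s
    ([psum_product_expansion]): the tuple contributes
    p_tau / (z_{rho^(1)} ... z_{rho^(s)}), where tau is the union of sigma and
    of all the m_i rho^(i).

    It remains to match, for a given tau, these tuples with the tableaux of
    shape tau ([ICRHT_weight_sum]).  Since rows are constant, a tableau is the
    same as a label on each row.  The tuple prescribes how many rows of each
    length in each component carry each label, and the increasing condition
    says that, among rows of equal length, the labels are sorted.  A component
    read from top to bottom is thus a list of (length, label) pairs, sorted by
    decreasing length and then by increasing label, whose multiset of entries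
    is known: there is exactly one such list. *)

Set Implicit Arguments.
Unset Strict Implicit.
Unset Printing Implicit Defensive.

Import GRing.Theory Num.Theory.
Local Open Scope classical_set_scope.
Local Open Scope ring_scope.

Local Notation tsize := Defs.tsize.

(** * Sums and lists *)

Lemma big_pred1_uniq (R : Type) (idx : R) (op : Monoid.com_law idx)
    (I : eqType) (r : seq I) (i : I) (F : I -> R) : uniq r -> i \in r ->
  \big[op/idx]_(j <- r | j == i) F j = F i.
Proof.
move=> ur ir; rewrite big_mkcond (bigD1_seq i) //= eqxx big1 ?Monoid.mulm1 //.
by move=> j /negbTE ->.
Qed.

Lemma perm_flatten_map (I T : eqType) (f g : I -> seq T) (s : seq I) :
  (forall i, i \in s -> perm_eq (f i) (g i)) ->
  perm_eq (flatten [seq f i | i <- s]) (flatten [seq g i | i <- s]).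
Proof.
elim: s => //= i s IH h; apply: perm_cat; first by apply: h; rewrite mem_head.
by apply: IH => j js; apply: h; rewrite inE js orbT.
Qed.

(** * Types as multisets of blocks *)

Lemma block_ge_total : total block_ge.
Proof. by move=> [a b] [c d]; rewrite /block_ge /=; lia. Qed.

Lemma block_ge_trans : transitive block_ge.
Proof. by move=> [a b] [c d] [e f]; rewrite /block_ge /=; lia. Qed.

Lemma block_ge_anti : antisymmetric block_ge.
Proof.
move=> [a b] [c d]; rewrite /block_ge /= => h.
by have [-> ->] : a = c /\ b = d by lia.
Qed.

Lemma btype_blocks (tau : btype) : all is_block tau.
Proof. by case: tau => s /= /andP[]. Qed.

Lemma btype_sorted (tau : btype) : sorted block_ge tau.
Proof. by case: tau => s /= /andP[]. Qed.

Lemma btype_of_subproof (l : seq (nat * nat)) :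
  all is_block (sort block_ge (filter is_block l))
  && sorted block_ge (sort block_ge (filter is_block l)).
Proof. by rewrite all_sort filter_all (sort_sorted block_ge_total). Qed.

(** Pairs that are not blocks are dropped, which makes the map total. *)
Definition btype_of (l : seq (nat * nat)) : btype := BType (btype_of_subproof l).

Lemma perm_btype_of (l : seq (nat * nat)) :
  all is_block l -> perm_eq (btype_of l) l.
Proof. by move=> /all_filterP h; rewrite /= h perm_sort. Qed.

(** A type is a sorted list, hence it is determined by its multiset of blocks. *)
Lemma btype_perm_inj (t u : btype) : perm_eq t u -> t = u.
Proof.
move=> h; apply: val_inj.
exact: (sorted_eq block_ge_trans block_ge_anti (btype_sorted t) (btype_sorted u)).
Qed.

Lemma count_restr (tau : btype) k r :
  count_mem r (restr tau k) = count_mem (k, r) tau.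
Proof.
rewrite /restr count_map count_filter; apply: eq_count => -[a b] /=.
by rewrite xpair_eqE andbC.
Qed.

Lemma btype_restr_inj (t u : btype) :
  (forall k, perm_eq (restr t k) (restr u k)) -> t = u.
Proof.
move=> h; apply: btype_perm_inj; apply/allP => -[k r] _; apply/eqP.
by rewrite -!count_restr; apply/permP.
Qed.

Lemma restr_gt0 (tau : btype) k r : r \in restr tau k -> (0 < k)%N && (0 < r)%N.
Proof.
move=> /mapP[[a b]]; rewrite mem_filter /= => /andP[/eqP <- h] ->.
by have /allP/(_ _ h) := btype_blocks tau.
Qed.

Lemma restr_sorted (tau : btype) k : sorted geq (restr tau k).
Proof.
rewrite /restr; have := btype_sorted tau.
move=> /(sorted_filter block_ge_trans (fun b => b.1 == k)).
rewrite sorted_map; apply: sub_in_sorted (filter_all _ _).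
by move=> [a b] [c d] /eqP /= -> /eqP /= ->; rewrite /block_ge /=; lia.
Qed.

Lemma block_le_tsize (tau : btype) b : b \in blocks tau ->
  (b.1 * b.2 <= tsize tau)%N.
Proof. by move=> h; rewrite /tsize (big_rem _ h) /= leq_addr. Qed.

Lemma restr_tsize (tau : btype) k r : r \in restr tau k ->
  (k <= tsize tau)%N /\ (r <= tsize tau)%N.
Proof.
move=> h; have := restr_gt0 h; move/mapP: h => [[a b]].
rewrite mem_filter /= => /andP[/eqP -> h] -> /andP[k0 b0].
by have := block_le_tsize h; rewrite /=; nia.
Qed.

Lemma restr_nil (tau : btype) k : (tsize tau < k)%N -> restr tau k = [::].
Proof.
case E: (restr tau k) => [//|r s] h.
have /restr_tsize [h' _] : r \in restr tau k by rewrite E mem_head.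
by move: h; rewrite ltnNge h'.
Qed.

(** * Enumeration of the types of a given size *)

(** A type of [d] has at most [d] blocks, with degrees and multiplicities at
    most [d]. *)
Lemma finite_tsize d : finite_set [set tau : btype | tsize tau = d].
Proof.
pose h (s : d.-bseq ('I_d.+1 * 'I_d.+1)) : btype :=
  btype_of [seq (nat_of_ord x.1, nat_of_ord x.2) | x <- s].
apply: (@sub_finite_set _ _ (h @` setT)); last exact/finite_image/finite_finset.
move=> tau /= td.
pose g (b : nat * nat) : 'I_d.+1 * 'I_d.+1 := (inord b.1, inord b.2).
have sz : (size (map g tau) <= d)%N.
  rewrite size_map -td /tsize -sum1_size big_seq [leqRHS]big_seq.
  apply: leq_sum => b bt; have /allP/(_ _ bt) := btype_blocks tau.
  by rewrite /is_block => /andP[b1 b2]; rewrite muln_gt0 b1.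
exists (Bseq sz) => //; rewrite /h /= -map_comp.
have -> : map ((fun x : 'I_d.+1 * 'I_d.+1 => (nat_of_ord x.1, nat_of_ord x.2)) \o g) tau
    = tau.
  rewrite -[RHS]map_id; apply/eq_in_map => -[a b] bt /=.
  have := block_le_tsize bt; have /allP/(_ _ bt) := btype_blocks tau.
  rewrite /is_block td /= => /andP[a0 b0] le.
  by rewrite !inordK //; nia.
exact/btype_perm_inj/perm_btype_of/btype_blocks.
Qed.

Definition types (d : nat) : seq btype :=
  enum_fset (fset_set [set tau : btype | tsize tau = d]).

Lemma mem_types d tau : (tau \in types d) = (tsize tau == d).
Proof.
apply/idP/eqP; rewrite /types -[_ \in enum_fset _]/(_ \in fset_set _).
  by rewrite in_fset_set; [move/set_mem | exact: finite_tsize].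
by move=> h; rewrite in_fset_set; [apply/mem_set | exact: finite_tsize].
Qed.

Lemma types_uniq d : uniq (types d).
Proof. exact: fset_uniq. Qed.

Lemma tsize_eq0 (tau : btype) : tsize tau = 0%N -> tau = empty_type.
Proof.
move=> t0; apply: val_inj => /=; case E: (blocks tau) => [//|b s].
have bt : b \in blocks tau by rewrite E mem_head.
have := block_le_tsize bt; have /allP/(_ _ bt) := btype_blocks tau.
by rewrite /is_block t0 leqn0 muln_eq0; case: b {bt E} => -[|k] [|r].
Qed.

Lemma types0 : types 0 = [:: empty_type].
Proof.
apply: perm_small_eq => //; apply: uniq_perm (types_uniq 0) _ _ => // tau.
rewrite mem_types inE; apply/eqP/eqP => [/tsize_eq0 //| ->].
by rewrite /tsize big_nil.
Qed.

(** * Power sums and centralizer orders, block by block *)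

(** A range of blocks common to all the types of size at most [N], so that sums
    over types and over their blocks can be exchanged. *)
Definition box (N : nat) : seq (nat * nat) :=
  [seq (k, r) | k <- iota 1 N, r <- iota 1 N].

Lemma box_uniq N : uniq (box N).
Proof. by apply: allpairs_uniq; rewrite ?iota_uniq // => -[? ?] []. Qed.

Lemma mem_box N k r : ((k, r) \in box N) =
  [&& (0 < k)%N, (0 < r)%N, (k <= N)%N & (r <= N)%N].
Proof.
apply/allpairsP/idP => [[[a b] /= [+ + [-> ->]]]|]; rewrite ?mem_iota; first by lia.
by move=> h; exists (k, r); rewrite /= !mem_iota; split=> //; lia.
Qed.

Lemma mem_box_tsize (tau : btype) N b : (tsize tau <= N)%N ->
  b \in blocks tau -> b \in box N.
Proof.
case: b => k r tN bt; have := block_le_tsize bt.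
have /allP/(_ _ bt) := btype_blocks tau; rewrite /is_block mem_box /=.
by nia.
Qed.

(** The range of the product no longer depends on the type, so that the values
    at two types of different sizes can be compared factor by factor. *)
Lemma ztensor_box (tau : btype) N : (tsize tau <= N)%N ->
  ztensor tau =
    (\prod_(b <- box N) (b.2 ^ count_mem b tau * (count_mem b tau)`!))%N.
Proof.
move=> tN; rewrite /box big_allpairs /ztensor.
have zE k : zpart (restr tau k) = (\prod_(r <- iota 1 N)
    (r ^ count_mem (k, r) tau * (count_mem (k, r) tau)`!))%N.
  pose F r := (r ^ count_mem r (restr tau k) * (count_mem r (restr tau k))`!)%N.
  pose M := maxn N (sumn (restr tau k)).
  (* indices beyond the largest part contribute the factor 1 *)
  have sub A : (A <= M)%N -> (forall r, r \in restr tau k -> (r <= A)%N) ->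
      (\prod_(1 <= r < A.+1) F r = \prod_(1 <= r < M.+1) F r)%N.
    move=> AM hA; rewrite [RHS](@big_cat_nat _ _ _ A.+1) //=.
    rewrite [X in (_ * X)%N]big_nat [X in (_ * X)%N]big1 ?muln1 // => r /andP[rA _].
    rewrite /F (count_memPn _) ?expn0 //.
    by apply/negP => /hA; rewrite leqNgt rA.
  rewrite /zpart (sub _ (leq_maxr _ _)) => [|r rt]; last first.
    by rewrite sumnE (big_rem _ rt) /= leq_addr.
  rewrite -(sub _ (leq_maxl _ _)) => [|r /restr_tsize[_ h]]; last exact: leq_trans h tN.
  by rewrite /index_iota subSS subn0; apply: eq_bigr => r _; rewrite /F count_restr.
rewrite -(big_mkord xpredT (fun i => zpart (restr tau i.+1))).
rewrite -(big_add1 _ _ 0 (tsize tau).+1 xpredT (fun k => zpart (restr tau k))).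
transitivity (\prod_(1 <= k < N.+1) zpart (restr tau k))%N.
  rewrite [RHS](@big_cat_nat _ _ _ (tsize tau).+1) //=.
  rewrite [X in (_ * X)%N]big_nat [X in (_ * X)%N]big1 ?muln1 // => k /andP[tk _].
  by rewrite restr_nil // /zpart big_geq.
by rewrite /index_iota subSS subn0; apply: eq_bigr => k _; exact: zE.
Qed.

(** [psum] counts degrees from 0, hence the predecessor. *)
Definition psum_block (b : nat * nat) : polysym := psum b.1.-1 b.2.

Lemma ptensorE (tau : btype) : ptensor tau = \prod_(b <- tau) psum_block b.
Proof.
rewrite /ptensor -(big_mkord xpredT (fun i => \prod_(r <- restr tau i.+1) psum i r)).
transitivity (\prod_(0 <= i < tsize tau) \prod_(b <- tau | b.1 == i.+1) psum_block b).
  apply: eq_bigr => i _; rewrite /restr big_map big_filter.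
  by apply: eq_bigr => b /eqP; rewrite /psum_block => ->.
rewrite (exchange_big_dep xpredT) //= big_seq [RHS]big_seq.
apply: eq_bigr => b bt; have /allP/(_ _ bt) := btype_blocks tau.
case: b bt => k r bt /andP[/= k0 r0].
have := block_le_tsize bt => /= le.
rewrite big_mkcond (bigD1_seq k.-1) ?iota_uniq ?mem_index_iota //=; last by nia.
rewrite prednK // eqxx big1 ?mulr1 // => i ik; case: eqP => // ki.
by rewrite ki eqxx in ik.
Qed.

(** * Coefficients *)

Definition mon_of (D : {fset var}) (F : var -> nat) : mon :=
  mkcmonom [fsfun v in D => F v | 0%N].

Lemma mon_ofE D F v : (v \notin D -> F v = 0%N) -> mon_of D F v = F v.
Proof. by move=> h; rewrite cmE fsfun_fun; case: ifPn => // /h. Qed.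

Lemma mon0 (M : mon) v : v \notin finsupp M -> M v = 0%N.
Proof. by rewrite -cmE_eq0 => /eqP. Qed.

Lemma scoef_scale (a : rat) (f : polysym) m : pser (a *: f) m = a * pser f m.
Proof. by []. Qed.

Lemma scoef_sum I (r : seq I) (P : pred I) (F : I -> polysym) m :
  pser (\sum_(i <- r | P i) F i) m = \sum_(i <- r | P i) pser (F i) m.
Proof. exact: (big_morph (fun f : polysym => pser f m)). Qed.

(** These are the monomials that survive when every variable is replaced by its
    [n]-th power. *)
Definition npower (n : nat) (M : mon) : bool := all (fun v => n %| M v)%N (finsupp M).

Lemma npowerP n (M : mon) : reflect (forall v : var, n %| M v)%N (npower n M).
Proof.
apply: (iffP allP) => [h v|h v _]; last exact: h.
by have [/h //|/mon0 ->] := boolP (v \in finsupp M); rewrite dvdn0.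
Qed.

Lemma scoef_Hblock d n M : (0 < n)%N ->
  pser (Hblock (d, n)) M = (npower n M && (wdeg M == n * d)%N)%:R.
Proof.
move=> n0 /=.
have [/npowerP nM|nM] /= := boolP (npower n M); last first.
  rewrite (_ : mkset _ = set0) ?fsbig_set0 //; apply/seteqP; split=> // N /= NM.
  by case/npowerP: nM => v; rewrite -NM expcmnE dvdn_mulr.
pose N := mon_of (finsupp M) (fun v => M v %/ n)%N.
have NE v : N v = (M v %/ n)%N.
  by apply: mon_ofE => vM; rewrite mon0 // div0n.
have MN : expcmn N n = M by apply: monP => v; rewrite expcmnE NE mulnC divnK.
rewrite (_ : mkset _ = [set N]) ?fsbig_set1.
  by rewrite -MN wdegX eqn_pmul2l.
apply/seteqP; split=> [L /= LM | L /= -> //].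
by apply: monP => v; rewrite NE -LM expcmnE mulKn.
Qed.

(** This is a quotient by the [r]-th power of [v] only if [r <= m v]. *)
Definition mon_divX (m : mon) (v : var) (r : nat) : mon :=
  mon_of (finsupp m) (fun w => m w - r * (v == w))%N.

Lemma mon_divXE m v r w : mon_divX m v r w = (m w - r * (v == w))%N.
Proof. by apply: mon_ofE => wm; rewrite mon0. Qed.

Lemma mon_divXK (m : mon) v r : (r <= m v)%N ->
  mmul (expcmn (monX v) r) (mon_divX m v r) = m.
Proof.
move=> rm; apply: monP => w; rewrite monM expcmnE cmU mon_divXE.
by case: eqVneq => [<-|_]; rewrite ?muln1 ?muln0 ?add0n ?subn0 // subnKC.
Qed.

(** Each factorization of [m] as x_{i,j}^r times a monomial is determined by the
    variable, because [r > 0]. *)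
Lemma scoef_psumM i r (f : polysym) m : (0 < r)%N ->
  pser (psum i r * f) m =
  \sum_(v <- finsupp m | (v.1 == i) && (r <= m v)%N) pser f (mon_divX m v r).
Proof.
move=> r0.
pose L := [seq (expcmn (monX v) r : mon, mon_divX m v r) |
   v <- [seq v <- finsupp m | (v.1 == i) && (r <= m v)%N]].
have uL : uniq L.
  rewrite map_inj_uniq ?filter_uniq ?fset_uniq // => v w [/(congr1 (fun M : mon => M v)) + _].
  rewrite !expcmnE !cmU eqxx; case: (eqVneq w v) => // _; lia.
rewrite -[LHS]/(smul (psum_series i r) (pser f) m) /=.
have LA p : p \in L -> mmul p.1 p.2 = m.
  by move=> /mapP[v]; rewrite mem_filter => /andP[/andP[_ rm] _] -> /=; rewrite mon_divXK.
rewrite (fsbigE L _ uL); last first.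
- move=> [a b] /= abm abL; case: asboolP => [[j aE]|]; last by rewrite mul0r.
  have av v : a v = (r * ((i, j) == v))%N by rewrite aE expcmnE cmU.
  have bE : b = mon_divX m (i, j) r.
    by apply: monP => v; rewrite mon_divXE -abm monM av addKn.
  have rm : (r <= m (i, j))%N by rewrite -abm monM av eqxx muln1 leq_addr.
  case/negP: abL; apply/mapP; exists (i, j); last by rewrite aE bE.
  rewrite mem_filter /= eqxx rm /=; apply/negPn/negP => /mon0 m0.
  by rewrite m0 leqNgt r0 in rm.
- by move=> p /LA.
transitivity (\sum_(p <- L) (psum_series i r p.1 * pser f p.2)).
  rewrite big_seq_cond [RHS]big_seq; apply: eq_bigl => p.
  by rewrite andb_idr // => /LA h; apply/mem_set.
rewrite big_map big_filter; apply: eq_bigr => -[k j] /andP[/= /eqP -> _].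
by case: asboolP => [_|[]]; [rewrite mul1r | exists j].
Qed.

(** * A recursion for the complete functions *)

Lemma wdeg_divX (m : mon) v r : (r <= m v)%N ->
  wdeg m = (r * v.1.+1 + wdeg (mon_divX m v r))%N.
Proof.
move=> rm; rewrite -{1}(mon_divXK rm) wdegM wdegX; congr (_ * _ + _)%N.
by rewrite /wdeg mdomU big_seq_fset1 cmUU mul1n.
Qed.

Lemma npower_divX n (m : mon) v r : (n * r <= m v)%N ->
  npower n (mon_divX m v (n * r)) = npower n m.
Proof.
move=> rm; apply/npowerP/npowerP => h w; have := h w; rewrite mon_divXE.
  case: eqVneq => [<-|_]; rewrite ?muln0 ?subn0 // muln1 => h'.
  by rewrite -(subnK rm) dvdn_add ?dvdn_mulr.
by case: eqVneq => [<-|_] h'; rewrite ?muln0 ?subn0 // muln1 dvdn_sub ?dvdn_mulr.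
Qed.

Lemma count_iota_leq q d : (q <= d)%N -> count (fun r => r <= q)%N (iota 1 d) = q.
Proof.
move=> qd; rewrite -(subnKC qd) iotaD count_cat.
rewrite (eq_in_count (a2 := predT)); last by move=> r; rewrite mem_iota /=; lia.
rewrite [X in (_ + X)%N](eq_in_count (a2 := pred0)); last by move=> r; rewrite mem_iota /=; lia.
by rewrite count_predT count_pred0 size_iota addn0.
Qed.

Lemma box_row_sum k q d : (0 < k)%N -> (q * k <= d)%N ->
  (\sum_(b <- box d | (b.1 == k) && (b.2 <= q)) b.1)%N = (q * k)%N.
Proof.
move=> k0 qkd; have [->|q0] := posnP q.
  rewrite big_seq_cond big1 // => -[a b].
  by rewrite mem_box => /andP[/and4P[_ b0 _ _] /andP[_ /=]]; rewrite leqNgt b0.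
have qd : (q <= d)%N by nia.
have kd : (k <= d)%N by nia.
rewrite big_mkcond big_allpairs (bigD1_seq k) ?iota_uniq ?mem_iota //=; last by lia.
rewrite [X in (_ + X)%N]big1 ?addn0 => [|i /negbTE ik]; last first.
  by rewrite big1 // ik.
rewrite eqxx -big_mkcond big_const_seq iter_addn addn0 mulnC /=.
by rewrite count_iota_leq.
Qed.

(** If [M] is the [n]-th power of N, the condition on [v] and [b] says that N is
    divisible by the power of [v] with exponent [b.2]: for each variable, there
    are as many such exponents as its multiplicity in N. *)
Lemma wdeg_root_count n d (M : mon) : (0 < n)%N -> npower n M -> wdeg M = (n * d)%N ->
  (\sum_(b <- box d | b.1 * b.2 <= d)
     \sum_(v <- finsupp M | (v.1 == b.1.-1) && (n * b.2 <= M v)) b.1)%N = d.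
Proof.
move=> n0 /npowerP nM Md.
have vd v : v \in finsupp M -> (M v * v.1.+1 <= n * d)%N.
  by move=> vM; rewrite -Md /wdeg (big_fsetD1 v) //= leq_addr.
apply/eqP; rewrite -(eqn_pmul2l n0) -Md /wdeg; apply/eqP.
rewrite (exchange_big_dep xpredT) //= big_distrr /= big_seq [RHS]big_seq.
apply: eq_bigr => v /vd {}vd; have := nM v => /dvdnP[q qE].
rewrite qE mulnAC [RHS]mulnC; congr (_ * _)%N.
have qkd : (q * v.1.+1 <= d)%N.
  by rewrite -(leq_pmul2l n0); move: vd; rewrite qE; lia.
rewrite -(box_row_sum (ltn0Sn v.1) qkd) big_seq_cond [RHS]big_seq_cond.
apply: eq_bigl => -[k r]; rewrite mem_box /= [(q * n)%N]mulnC leq_pmul2l //.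
by case: k => //= k; rewrite eqSS; apply/idP/idP; nia.
Qed.

(** Dividing [M] by an [n r]-th power changes neither whether it is an [n]-th
    power nor whether it has the right degree, so that every pair counted by
    [wdeg_root_count] contributes the same coefficient. *)
Lemma Hblock_rec n d : (0 < n)%N ->
  d%:R *: Hblock (d, n) = \sum_(b <- box d | (b.1 * b.2 <= d)%N)
    b.1%:R *: (psum_block (b.1, n * b.2)%N * Hblock (d - b.1 * b.2, n)%N).
Proof.
move=> n0; apply/val_inj/seriesP => M.
rewrite -/(pser _) scoef_sum scoef_scale scoef_Hblock //.
(* the coefficient of [M] in H_{d^n} *)
pose g := npower n M && (wdeg M == n * d)%N.
transitivity (\sum_(b <- box d | (b.1 * b.2 <= d)%N)
  \sum_(v <- finsupp M | (v.1 == b.1.-1) && (n * b.2 <= M v)%N) (b.1%:R * g%:R : rat)).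
  rewrite -/g; case gE: g; last by rewrite mulr0 big1 // => b _; rewrite big1 // mulr0.
  move/andP: gE => [nM /eqP Md]; rewrite mulr1 -{1}(wdeg_root_count n0 nM Md).
  rewrite natr_sum; apply: eq_bigr => b _; rewrite natr_sum.
  by apply: eq_bigr => v _; rewrite mulr1.
rewrite big_seq_cond [RHS]big_seq_cond; apply: eq_bigr => -[k r].
rewrite mem_box => /andP[/and4P[k0 r0 _ _] krd].
rewrite scoef_scale scoef_psumM ?muln_gt0 ?n0 // mulr_sumr.
apply: eq_bigr => v /andP[/eqP vk rM]; rewrite scoef_Hblock // npower_divX //.
congr (_ * (_ && _)%:R); rewrite /= in vk rM krd *.
rewrite /g (wdeg_divX rM) vk prednK //; apply/eqP/eqP; nia.
Qed.

Lemma Hblock0 n : (0 < n)%N -> Hblock (0, n)%N = 1.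
Proof.
move=> n0; apply/val_inj/seriesP => M; rewrite -/(pser _) scoef_Hblock // muln0.
rewrite -[RHS]/((M == mone)%:R); congr (nat_of_bool _)%:R.
apply/andP/eqP => [[_ /eqP M0]|->]; last first.
  by split; [apply/npowerP => v; rewrite cm1 dvdn0 | rewrite wdeg1].
apply: monP => v; rewrite cm1; apply/eqP/negPn/negP.
rewrite cmE_neq0 => vM; move: M0; rewrite /wdeg (big_fsetD1 v) //= => /eqP.
by rewrite addn_eq0 muln_eq0 orbF cmE_eq0 vM.
Qed.

(** * The power-sum expansion of the complete functions *)

Definition insert_block (b : nat * nat) (tau : btype) : btype := btype_of (b :: tau).

Lemma perm_insert_block b tau : is_block b -> perm_eq (insert_block b tau) (b :: tau).
Proof. by move=> hb; apply: perm_btype_of; rewrite /= hb btype_blocks. Qed.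

Lemma perm_tsize (tau : btype) l : perm_eq tau l ->
  tsize tau = (\sum_(b <- l) b.1 * b.2)%N.
Proof. by move=> h; rewrite /tsize (perm_big _ h). Qed.

Lemma tsize_insert_block b tau : is_block b ->
  tsize (insert_block b tau) = (b.1 * b.2 + tsize tau)%N.
Proof. by move=> hb; rewrite (perm_tsize (perm_insert_block tau hb)) big_cons. Qed.

Lemma count_insert_block b tau c : is_block b ->
  count_mem c (insert_block b tau) = ((b == c) + count_mem c tau)%N.
Proof. by move=> hb; have /permP -> := perm_insert_block tau hb. Qed.

(** If k^r occurs m times, one more copy multiplies r ^ m * m! by r * (m + 1). *)
Lemma ztensor_insert_block b tau : is_block b ->
  ztensor (insert_block b tau) = (ztensor tau * (b.2 * (count_mem b tau).+1))%N.
Proof.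
move=> hb; have tN := tsize_insert_block tau hb.
have bN : b \in box (tsize (insert_block b tau)).
  by apply: (mem_box_tsize (leqnn _)); rewrite (perm_mem (perm_insert_block tau hb)) mem_head.
rewrite (ztensor_box (leqnn _)) (@ztensor_box tau (tsize (insert_block b tau))); last first.
  by rewrite tN leq_addl.
rewrite !(bigD1_seq _ bN (box_uniq _)) /= count_insert_block // eqxx.
rewrite [X in (_ * X)%N = _](eq_bigr
  (fun c => c.2 ^ count_mem c tau * (count_mem c tau)`!)%N); last first.
  by move=> c /negbTE cb; rewrite count_insert_block // eq_sym cb.
by rewrite add1n expnS factS mulnACA -[LHS]mulnA mulnC.
Qed.

(** Inserting a block and removing one copy of it are inverse to each other. *)
Lemma types_with_block b d : is_block b -> (b.1 * b.2 <= d)%N ->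
  perm_eq [seq tau <- types d | b \in blocks tau]
          [seq insert_block b tau | tau <- types (d - b.1 * b.2)].
Proof.
move=> hb bd; have inj : injective (insert_block b).
  move=> t u tu; apply: btype_perm_inj; rewrite -(perm_cons b).
  rewrite -(permPl (perm_insert_block t hb)) tu.
  exact: perm_insert_block.
apply: uniq_perm; rewrite ?filter_uniq ?(map_inj_uniq inj) ?types_uniq // => tau.
rewrite mem_filter mem_types; apply/andP/mapP => [[bt /eqP td]|[u + ->]].
  have rem_blocks : all is_block (rem b tau).
    by apply/allP => c /mem_rem; apply/allP/btype_blocks.
  have E : tau = insert_block b (btype_of (rem b tau)).
    apply: btype_perm_inj; rewrite (permPl (perm_to_rem bt)) perm_sym.
    rewrite (permPl (perm_insert_block _ hb)) perm_cons.
    exact: perm_btype_of.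
  exists (btype_of (rem b tau)) => //.
  by rewrite mem_types -td {2}E tsize_insert_block // addKn.
rewrite mem_types => /eqP ud; rewrite tsize_insert_block // ud subnKC //; split => //.
by rewrite (perm_mem (perm_insert_block u hb)) mem_head.
Qed.

(** p^tensor with all the variables raised to the [n]-th power. *)
Definition power_psum (n : nat) (tau : btype) : polysym :=
  \prod_(b <- tau) psum_block (b.1, n * b.2)%N.

Lemma power_psum_insert n b tau : is_block b ->
  power_psum n (insert_block b tau) = psum_block (b.1, n * b.2)%N * power_psum n tau.
Proof. by move=> hb; rewrite /power_psum (perm_big _ (perm_insert_block tau hb)) big_cons. Qed.

Lemma tsize_count_box (tau : btype) d : (tsize tau <= d)%N ->
  tsize tau = (\sum_(b <- box d) b.1 * b.2 * count_mem b tau)%N.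
Proof.
move=> td; rewrite /tsize.
transitivity (\sum_(b <- tau) \sum_(c <- box d | c == b) c.1 * c.2)%N.
  rewrite big_seq [RHS]big_seq; apply: eq_bigr => b bt.
  by rewrite big_pred1_uniq ?box_uniq ?(mem_box_tsize td bt).
rewrite (exchange_big_dep xpredT) //=; apply: eq_bigr => c _.
rewrite big_const_seq iter_addn addn0; congr (_ * _)%N.
by apply: eq_count => b; rewrite /= eq_sym.
Qed.

Lemma scale_mulr (a : rat) (f g : polysym) : f * (a *: g) = a *: (f * g).
Proof. by rewrite mulrC -scalerAl mulrC. Qed.

Definition psum_expansion (n d : nat) : polysym :=
  \sum_(tau <- types d) (ztensor tau)%:R^-1 *: power_psum n tau.

(** [d] times the coefficient of a type of [d] is split according to the blocks
    of the type; the share of a block is then moved to the type from which one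
    copy of this block has been removed. *)
Lemma psum_expansion_rec n d :
  d%:R *: psum_expansion n d = \sum_(b <- box d | (b.1 * b.2 <= d)%N)
    b.1%:R *: (psum_block (b.1, n * b.2)%N * psum_expansion n (d - b.1 * b.2)%N).
Proof.
(* the share of the block [b] in the term of [tau] *)
pose F b (tau : btype) : polysym :=
  ((b.1 * b.2 * count_mem b tau)%:R / (ztensor tau)%:R) *: power_psum n tau.
transitivity (\sum_(tau <- types d) \sum_(b <- box d) F b tau).
  rewrite scaler_sumr big_seq [RHS]big_seq; apply: eq_bigr => tau.
  rewrite mem_types => /eqP td; rewrite scalerA -scaler_suml -mulr_suml -natr_sum.
  by rewrite -tsize_count_box td.
rewrite exchange_big [RHS]big_mkcond big_seq [RHS]big_seq.
apply: eq_bigr => b; case: b => k r; rewrite mem_box => /and4P[k0 r0 _ _].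
set b := (k, r); have hb : is_block b by rewrite /is_block k0.
transitivity (\sum_(tau <- types d | b \in blocks tau) F b tau).
  rewrite [RHS]big_mkcond; apply: eq_bigr => tau _; case: ifPn => // bt.
  by rewrite /F (count_memPn bt) muln0 mul0r scale0r.
case: ifPn => bd; last first.
  rewrite big_seq_cond big1 // => tau /andP[]; rewrite mem_types => /eqP td bt.
  by rewrite -td block_le_tsize in bd.
rewrite -big_filter (perm_big _ (types_with_block hb bd)) big_map.
rewrite /psum_expansion mulr_sumr scaler_sumr; apply: eq_bigr => tau _.
rewrite /F power_psum_insert // scale_mulr scalerA; congr (_ *: _).
rewrite ztensor_insert_block // count_insert_block // eqxx add1n -mulnA.
rewrite !natrM -mulrA; congr (_ * _); rewrite -!natrM.
have c0 : ((b.2 * (count_mem b tau).+1)%:R : rat) != 0.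
  by rewrite pnatr_eq0 muln_eq0 orbF -lt0n.
by move: (b.2 * _)%N c0 => x c0; rewrite natrM invfM mulrCA divff // mulr1.
Qed.

(** By strong induction, since [d.+1] is invertible in the rational numbers. *)
Lemma Hblock_expansion n d : (0 < n)%N -> Hblock (d, n) = psum_expansion n d.
Proof.
move=> n0; elim/ltn_ind: d => -[_|d IH].
  rewrite Hblock0 // /psum_expansion types0 big_seq1 /power_psum big_nil.
  by rewrite /ztensor /tsize !big_nil big_ord0 invr1 scale1r.
have d0 : (d.+1%:R : rat) != 0 by rewrite pnatr_eq0.
apply: (scalerI d0); rewrite Hblock_rec // psum_expansion_rec.
rewrite big_seq_cond [RHS]big_seq_cond; apply: eq_bigr => -[k r].
rewrite mem_box => /andP[/and4P[k0 r0 _ _] krd]; rewrite IH //.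
by move: krd => /=; nia.
Qed.

(** * The expansion of the product *)

(** The tuples (rho^(1), ..., rho^(s)) indexing the terms of the product of the
    expansions of the factors. *)
Fixpoint choices (delta : seq (nat * nat)) : seq (seq btype) :=
  if delta is b :: delta' then
    [seq rho :: c | rho <- types b.1, c <- choices delta']
  else [:: [::]].

Lemma mem_choices delta c :
  (c \in choices delta) = all2 (fun b rho => tsize rho == b.1) delta c.
Proof.
elim: delta c => [|b delta IH] [|rho c] //=.
  by apply/allpairsP => -[[? ?] []].
apply/allpairsP/idP => [[[x y] /= []]|].
  by rewrite mem_types IH => xb yc [-> ->]; rewrite xb.
by move=> /andP[h1 h2]; exists (rho, c); rewrite /= mem_types IH.
Qed.

Lemma choices_uniq delta : uniq (choices delta).
Proof.
elim: delta => [//|b delta IH] /=.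
by apply: allpairs_uniq; rewrite ?types_uniq // => -[? ?] [? ?] _ _ /= [-> ->].
Qed.

Lemma choicesP delta c : reflect
  (size c = size delta /\ forall i, (i < size delta)%N ->
     tsize (nth empty_type c i) = (nth (0, 0)%N delta i).1)
  (c \in choices delta).
Proof.
rewrite mem_choices; elim: delta c => [|b delta IH] [|rho c] /=.
- by left.
- by right=> -[].
- by right=> -[].
apply: (iffP andP) => [[/eqP rb /IH[sz h]]|[[sz] h]].
  by split=> [|[|i]]; rewrite ?sz //=; apply: h.
by split; [apply/eqP/(h 0%N) | apply/IH; split=> // i; apply: (h i.+1)].
Qed.

Definition choice_weight (c : seq btype) : rat :=
  \prod_(rho <- c) (ztensor rho)%:R^-1.

(** Raising the variables to the m-th power turns p_{k^r} into p_{k^(m r)}: the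
    multiplicities are scaled, the degrees are kept. *)
Definition dilated_blocks (delta : seq (nat * nat)) (c : seq btype) : seq (nat * nat) :=
  flatten [seq [seq (b.1, x.1.2 * b.2)%N | b <- blocks x.2] | x <- zip delta c].

Lemma Hprod_expansion delta : all is_block delta ->
  Hprod delta = \sum_(c <- choices delta)
    choice_weight c *: \prod_(b <- dilated_blocks delta c) psum_block b.
Proof.
rewrite /Hprod /choice_weight; elim: delta => [_|[d m] delta IH] /=.
  by rewrite big_nil big_seq1 !big_nil scale1r.
move=> /andP[/andP[_ m0] /IH {}IH]; rewrite big_cons IH Hblock_expansion //.
rewrite big_allpairs_dep mulr_suml.
apply: eq_bigr => rho _; rewrite mulr_sumr; apply: eq_bigr => c _.
rewrite big_cons /dilated_blocks /= big_cat big_map /=.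
by rewrite scale_mulr -scalerAl scalerA mulrC.
Qed.

(** The union, as multisets of blocks, of sigma and of all the m_i rho^(i). *)
Definition combine sigma delta c : btype := btype_of (blocks sigma ++ dilated_blocks delta c).

Lemma perm_combine sigma delta c : all is_block delta ->
  perm_eq (combine sigma delta c) (blocks sigma ++ dilated_blocks delta c).
Proof.
move=> hd; apply: perm_btype_of; rewrite all_cat btype_blocks /=.
elim: delta c hd => [|[d m] delta IH] [|rho c] //= /andP[/andP[_ m0] /IH {}IH].
rewrite /dilated_blocks /= all_cat IH andbT all_map; apply/allP => b.
move=> /(allP (btype_blocks rho)) /andP[/= b1 b2].
by rewrite /is_block /= b1 muln_gt0 m0.
Qed.

Lemma psum_product_expansion sigma delta : all is_block delta ->
  ptensor sigma * Hprod delta = \sum_(c <- choices delta)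
    choice_weight c *: ptensor (combine sigma delta c).
Proof.
move=> hd; rewrite Hprod_expansion // mulr_sumr; apply: eq_bigr => c _.
rewrite scale_mulr !ptensorE; congr (_ *: _).
by rewrite (perm_big _ (perm_combine sigma c hd)) big_cat.
Qed.

(** The row lengths that the extended content prescribes for the label [i] in
    component [k]; label 0 belongs to [sigma], label [j.+1] to the [j]-th block. *)
Definition row_content sigma delta (c : seq btype) (i k : nat) : seq nat :=
  if i is j.+1 then [seq ((nth (0, 0) delta j).2 * r)%N | r <- restr (nth empty_type c j) k]
  else restr sigma k.

Lemma restr_combine sigma delta c k : all is_block delta -> size c = size delta ->
  perm_eq (restr (combine sigma delta c) k)
    (flatten [seq row_content sigma delta c i k | i <- iota 0 (size delta).+1]).
Proof.
move=> hd sz; rewrite /restr.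
have E := perm_combine sigma c hd.
rewrite (permPl (perm_map _ (perm_filter (fun b => b.1 == k) E))).
rewrite filter_cat map_cat /= perm_cat2l /dilated_blocks filter_flatten map_flatten.
rewrite -!map_comp (_ : map _ (zip _ _) =
  [seq row_content sigma delta c i k | i <- iota 1 (size delta)]) //.
apply: (@eq_from_nth _ [::]); rewrite !size_map size_zip sz minnn ?size_iota // => i id.
rewrite (nth_map ((0, 0)%N, empty_type)) ?size_zip ?sz ?minnn //.
rewrite (nth_map 0%N) ?size_iota // nth_iota // nth_zip //=.
by rewrite /restr filter_map -!map_comp.
Qed.

(** * Tableaux as sorted lists of labelled rows *)

(** The order in which the rows of a component of a tableau occur from top to
    bottom. *)
Definition row_ge (x y : nat * nat) : bool :=
  (y.1 < x.1)%N || (x.1 == y.1) && (x.2 <= y.2)%N.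

Lemma row_ge_total : total row_ge.
Proof. by move=> [a b] [c d]; rewrite /row_ge /=; lia. Qed.

Lemma row_ge_trans : transitive row_ge.
Proof. by move=> [a b] [c d] [e f]; rewrite /row_ge /=; lia. Qed.

Lemma row_ge_refl : reflexive row_ge.
Proof. by move=> [a b]; rewrite /row_ge /= eqxx leqnn orbT. Qed.

Lemma row_ge_anti : antisymmetric row_ge.
Proof.
move=> [a b] [c d]; rewrite /row_ge /= => h.
by have [-> ->] : a = c /\ b = d by lia.
Qed.

Lemma mem_dg tau k r j :
  ((k, r, j) \in dg tau) = (r < size (restr tau k))%N && (j < rowlen tau k r)%N.
Proof.
apply/allpairsPdep/andP => [[[a b] [x [/allpairsPdep[a' [b' [+ + [-> ->]]]] + [-> -> ->]]]]|].
  by rewrite !mem_iota.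
move=> [rk jr]; exists (k, r), j; split=> //; last by rewrite mem_iota.
apply/allpairsPdep; exists k, r; rewrite !mem_iota rk; split=> //.
have rt : nth 0%N (restr tau k) r \in restr tau k by exact: mem_nth.
by have [h _] := restr_tsize rt; have /andP[k0 _] := restr_gt0 rt; lia.
Qed.

Lemma rowlen_gt0 tau k r : (r < size (restr tau k))%N -> (0 < rowlen tau k r)%N.
Proof. by move=> /(mem_nth 0%N)/restr_gt0/andP[]. Qed.

Lemma cell_crow (tau : btype) (c : cell tau) : (crow c < size (restr tau (ccomp c)))%N.
Proof.
have := valP c; rewrite /ccomp /crow.
by case: (val c) => -[k r] j /=; rewrite mem_dg => /andP[].
Qed.

(** The first cell of a row stands for the row; the default value occurs only
    outside the diagram. *)
Definition row_label (tau : btype) s (T : filling tau s) (k r : nat) : nat :=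
  if insub (k, r, 0%N) is Some c then T c else 0%N.

Lemma row_label_cell (tau : btype) s (T : filling tau s) k r :
  (r < size (restr tau k))%N ->
  exists c : cell tau,
    [/\ ccomp c = k, crow c = r, ccol c = 0%N & row_label T k r = T c].
Proof.
move=> rk; have h : (k, r, 0%N) \in dg tau by rewrite mem_dg rk rowlen_gt0.
by exists (SeqSub h); rewrite /row_label insubT.
Qed.

Definition row_constant (tau : btype) s (T : filling tau s) : Prop :=
  forall c c' : cell tau, ccomp c = ccomp c' -> crow c = crow c' -> T c = T c'.

Lemma row_labelE (tau : btype) s (T : filling tau s) (c : cell tau) :
  row_constant T -> row_label T (ccomp c) (crow c) = T c.
Proof.
move=> hT; have [c' [h1 h2 _ ->]] := row_label_cell T (cell_crow c).
by congr nat_of_ord; apply: hT.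
Qed.

(** When rows are constant, these lists carry all the information in [T]: see
    [row_constant_inj]. *)
Definition labelled_rows (tau : btype) s (T : filling tau s) (k : nat) : seq (nat * nat) :=
  [seq (rowlen tau k r, row_label T k r) | r <- iota 0 (size (restr tau k))].

Lemma size_labelled_rows (tau : btype) s (T : filling tau s) k :
  size (labelled_rows T k) = size (restr tau k).
Proof. by rewrite size_map size_iota. Qed.

Lemma nth_labelled_rows (tau : btype) s (T : filling tau s) k r :
  (r < size (restr tau k))%N ->
  nth (0, 0)%N (labelled_rows T k) r = (rowlen tau k r, row_label T k r).
Proof. by move=> h; rewrite (nth_map 0%N) ?size_iota // nth_iota. Qed.

Lemma labelled_rows_lengths (tau : btype) s (T : filling tau s) k :
  [seq x.1 | x <- labelled_rows T k] = restr tau k.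
Proof.
rewrite -map_comp; apply: (@eq_from_nth _ 0%N); rewrite size_map size_iota // => r h.
by rewrite (nth_map 0%N) ?size_iota // nth_iota.
Qed.

Lemma labelled_rows_labels (tau : btype) s (T : filling tau s) k x :
  x \in labelled_rows T k -> (x.2 < s.+1)%N.
Proof.
move=> /mapP[r _ ->] /=; rewrite /row_label.
by case: insub => // c; apply: ltn_ord.
Qed.

Lemma filled_rowsE (tau : btype) s (T : filling tau s) i k : row_constant T ->
  filled_rows T i k = [seq x.1 | x <- labelled_rows T k & x.2 == i].
Proof.
move=> hT; rewrite /filled_rows /labelled_rows filter_map -map_comp.
congr map; apply: eq_in_filter => r; rewrite mem_iota add0n /= => rk.
apply/forallP/eqP => [h|rE c].
  have [c [ck cr _ ->]] := row_label_cell T rk.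
  by have := h c; rewrite ck cr !eqxx => /eqP.
by apply/implyP => /andP[/eqP ck /eqP cr]; rewrite -row_labelE // ck cr rE.
Qed.

Lemma row_constant_inj (tau : btype) s (T T' : filling tau s) :
  row_constant T -> row_constant T' ->
  (forall k, labelled_rows T k = labelled_rows T' k) -> T = T'.
Proof.
move=> hT hT' h; apply/ffunP => c; apply: val_inj => /=.
rewrite -!row_labelE //; have cc := cell_crow c.
have /(congr1 (fun w => (nth (0, 0)%N w (crow c)).2)) := h (ccomp c).
by rewrite !nth_labelled_rows.
Qed.

Lemma labelled_rows_sorted (tau : btype) s (T : filling tau s) k :
  (forall c c' : cell tau, ccomp c = ccomp c' -> ccol c = 0%N -> ccol c' = 0%N ->
     rowlen tau (ccomp c) (crow c) = rowlen tau (ccomp c') (crow c') ->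
     (crow c <= crow c')%N -> (T c <= T c')%N) ->
  sorted row_ge (labelled_rows T k).
Proof.
move=> hT; rewrite sorted_map.
have all_lt : all (fun r => r < size (restr tau k))%N (iota 0 (size (restr tau k))).
  by apply/allP => r; rewrite mem_iota.
apply: (sub_in_sorted _ all_lt (iota_ltn_sorted _ _)) => a b ak bk ab /=.
rewrite /row_ge /=.
have le : (rowlen tau k b <= rowlen tau k a)%N.
  by apply: (sorted_leq_nth (rev_trans leq_trans) leqnn 0%N (restr_sorted tau k)) => //; exact: ltnW.
move: le; rewrite leq_eqVlt => /predU1P[ba|->//]; rewrite ba eqxx /=.
have [c [ck ca c0 ->]] := row_label_cell T ak.
have [d [dk db d0 ->]] := row_label_cell T bk.
by rewrite hT ?orbT // ?ck ?dk ?ca ?db //; exact: ltnW.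
Qed.

(** A list is, up to order, the concatenation of its classes by label. *)
Lemma perm_flatten_labels (w : seq (nat * nat)) s :
  (forall x, x \in w -> (x.2 < s)%N) ->
  perm_eq [seq x.1 | x <- w]
    (flatten [seq [seq x.1 | x <- w & x.2 == i] | i <- iota 0 s]).
Proof.
move=> hw; rewrite (_ : flatten _ =
  [seq x.1 | x <- flatten [seq [seq x <- w | x.2 == i] | i <- iota 0 s]]); last first.
  by rewrite map_flatten -map_comp.
apply/perm_map/permP => a; rewrite count_flatten sumnE !big_map.
transitivity (\sum_(i <- iota 0 s) \sum_(x <- w | a x) (i == x.2))%N; last first.
  apply: eq_bigr => i _; rewrite count_filter -sum1_count -big_mkcondr /=.
  by apply: eq_bigl => x; rewrite eq_sym.
rewrite exchange_big /= -sum1_count big_seq_cond [RHS]big_seq_cond.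
apply: eq_bigr => x /andP[xw _]; rewrite -(@big_mkcond _ _ _ _ _ (fun i => i == x.2) (fun=> 1%N)).
by rewrite big_pred1_uniq ?iota_uniq ?mem_iota ?hw.
Qed.

(** * Tableaux and tuples of types *)

(** The conditions on the row lengths of every label of [T], for the types
    rho^(i) given explicitly as the entries of [c]. *)
Definition has_content (tau : btype) sigma delta (T : filling tau (size delta))
    (c : seq btype) : Prop :=
  forall i k, (i <= size delta)%N ->
    perm_eq (filled_rows T i k) (row_content sigma delta c i k).

Lemma is_rhoE (tau : btype) delta (T : filling tau (size delta)) i rho :
  is_rho T i rho <->
    tsize rho = (nth (0, 0)%N delta i).1 /\
    forall k, perm_eq (filled_rows T i.+1 k)
      [seq ((nth (0, 0) delta i).2 * b)%N | b <- restr rho k].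
Proof. by rewrite /is_rho; case: nth. Qed.

Lemma nth_block_gt0 delta i : all is_block delta -> (i < size delta)%N ->
  (0 < (nth (0, 0) delta i).2)%N.
Proof. by move=> hd id; have /andP[] := all_nthP (0, 0)%N hd i id. Qed.

(** The multiplicity of the block is positive, so that the scaled parts determine
    the parts. *)
Lemma is_rho_uniq (tau : btype) delta (T : filling tau (size delta)) i rho rho' :
  all is_block delta -> (i < size delta)%N ->
  is_rho T i rho -> is_rho T i rho' -> rho = rho'.
Proof.
move=> hd id /is_rhoE[_ h] /is_rhoE[_ h']; apply: btype_restr_inj => k.
have inj : injective (muln (nth (0, 0)%N delta i).2).
  by move=> a b /eqP; rewrite eqn_pmul2l ?nth_block_gt0 // => /eqP.
by apply: (perm_map_inj inj); rewrite -(permPl (h k)) h'.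
Qed.

Definition tableau_types (tau : btype) delta (T : filling tau (size delta)) : seq btype :=
  mkseq (fun i => xget empty_type [set rho | is_rho T i rho]) (size delta).

Lemma wtE (tau : btype) delta (T : filling tau (size delta)) :
  wt T = choice_weight (tableau_types T).
Proof.
rewrite /wt /choice_weight /tableau_types big_map.
rewrite -(big_mkord xpredT (fun i => (ztensor (xget empty_type [set rho | is_rho T i rho]))%:R^-1)).
by rewrite /index_iota subn0.
Qed.

Lemma tableau_types_content (tau : btype) sigma delta (T : filling tau (size delta)) :
  ICRHT sigma T ->
  tableau_types T \in choices delta /\ has_content sigma T (tableau_types T).
Proof.
move=> [_ T0 Trho _].
have rhoP i : (i < size delta)%N -> is_rho T i (nth empty_type (tableau_types T) i).
  by move=> id; rewrite nth_mkseq //; apply: (xgetPex empty_type (Trho i id)).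
split.
  apply/choicesP; split; first by rewrite size_mkseq.
  by move=> i /rhoP/is_rhoE[].
by move=> [|i] k id; [apply: T0 | have /is_rhoE[_] := rhoP i id].
Qed.

Lemma tableau_types_uniq (tau : btype) sigma delta (T : filling tau (size delta)) c :
  all is_block delta -> c \in choices delta -> has_content sigma T c ->
  tableau_types T = c.
Proof.
move=> hd /choicesP[sz ch] hc; apply: (@eq_from_nth _ empty_type).
  by rewrite size_mkseq.
rewrite size_mkseq => i id; rewrite nth_mkseq //.
have h : is_rho T i (nth empty_type c i).
  by apply/is_rhoE; split=> [|k]; [apply: ch | apply: (hc i.+1 k)].
by apply: (xget_unique empty_type h) => rho h'; apply: is_rho_uniq id h' h.
Qed.

(** Every row of a component has exactly one label, so that the prescribed rows
    together make up the shape. *)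
Lemma has_content_shape (tau : btype) sigma delta (T : filling tau (size delta)) c :
  all is_block delta -> size c = size delta -> row_constant T ->
  has_content sigma T c -> combine sigma delta c = tau.
Proof.
move=> hd sz hT hc; apply/esym/btype_restr_inj => k.
rewrite (permPr (restr_combine sigma k hd sz)) -(labelled_rows_lengths T k).
rewrite (permPl (perm_flatten_labels (@labelled_rows_labels _ _ T k))).
apply: perm_flatten_map => i; rewrite mem_iota add0n => id.
by rewrite -filled_rowsE //; apply: hc.
Qed.

(** The only possible component [k] of a tableau with content [c]: the prescribed
    (length, label) pairs, in sorted order. *)
Definition content_rows sigma delta (c : seq btype) (k : nat) : seq (nat * nat) :=
  sort row_ge (flatten
    [seq [seq (l, i) | l <- row_content sigma delta c i k] | i <- iota 0 (size delta).+1]).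

Lemma count_content_rows sigma delta c k l i : (i <= size delta)%N ->
  count_mem (l, i) (content_rows sigma delta c k) = count_mem l (row_content sigma delta c i k).
Proof.
move=> id; rewrite /content_rows count_sort count_flatten sumnE !big_map.
rewrite (bigD1_seq i) ?iota_uniq ?mem_iota //= [X in (_ + X)%N]big1 => [|j ji].
  by rewrite addn0 count_map; apply: eq_count => a; rewrite /= xpair_eqE eqxx andbT.
rewrite count_map (eq_count (a2 := pred0)) ?count_pred0 // => a /=.
by rewrite xpair_eqE (negbTE ji) andbF.
Qed.

Lemma content_rows_labels sigma delta c k x :
  x \in content_rows sigma delta c k -> (x.2 < (size delta).+1)%N.
Proof.
rewrite mem_sort => /flattenP[w /mapP[i + ->] /mapP[l _ ->]].
by rewrite mem_iota.
Qed.

Lemma content_rows_sorted sigma delta c k : sorted row_ge (content_rows sigma delta c k).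
Proof. exact: sort_sorted row_ge_total _. Qed.

Lemma content_rows_lengths sigma delta c k : all is_block delta -> size c = size delta ->
  [seq x.1 | x <- content_rows sigma delta c k] = restr (combine sigma delta c) k.
Proof.
move=> hd sz; apply: (sorted_eq (rev_trans leq_trans)).
- by move=> a b /andP[h1 h2]; apply/eqP; rewrite eqn_leq h1 h2.
- have := content_rows_sorted sigma delta c k; rewrite sorted_map.
  by apply: sub_sorted => -[a b] [e f]; rewrite /row_ge /=; lia.
- exact: restr_sorted.
rewrite (permPr (restr_combine sigma k hd sz)) /content_rows.
rewrite (permPl (perm_map _ (permEl (perm_sort _ _)))) map_flatten -map_comp.
apply: perm_flatten_map => i _ /=.
by rewrite -map_comp map_id.
Qed.

(** Two sorted lists with the same multiset of entries are equal. *)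
Lemma labelled_rows_content (tau : btype) sigma delta (T : filling tau (size delta)) c k :
  all is_block delta -> row_constant T -> has_content sigma T c ->
  sorted row_ge (labelled_rows T k) ->
  labelled_rows T k = content_rows sigma delta c k.
Proof.
move=> hd hT hc hs; apply: (sorted_eq row_ge_trans row_ge_anti hs).
  exact: content_rows_sorted.
apply/allP => -[l i] _; apply/eqP.
have [id|id] := leqP i (size delta).
  rewrite count_content_rows //; have /permP <- := hc i k id.
  rewrite filled_rowsE // [RHS]count_map [RHS]count_filter; apply: eq_count => -[a b] /=.
  by rewrite xpair_eqE.
by rewrite !(count_memPn _) //; apply/negP; [move/content_rows_labels | move/labelled_rows_labels];
  rewrite /= ltnS leqNgt id.
Qed.

Lemma tableau_types_inj (tau : btype) sigma delta (T T' : filling tau (size delta)) :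
  all is_block delta -> ICRHT sigma T -> ICRHT sigma T' ->
  tableau_types T = tableau_types T' -> T = T'.
Proof.
move=> hd hT hT' TT'.
have [_ hc] := tableau_types_content hT.
have [_] := tableau_types_content hT'; rewrite -TT' => hc'.
case: hT hT' => [T1 _ _ /labelled_rows_sorted T4] [T1' _ _ /labelled_rows_sorted T4'].
apply: row_constant_inj => // k.
by rewrite (labelled_rows_content hd T1 hc) // (labelled_rows_content hd T1' hc').
Qed.

(** The sorted lists [content_rows] have the right row lengths, and placing their
    labels in the rows gives a tableau. *)
Lemma tableau_exists sigma delta c (tau := combine sigma delta c) :
  all is_block delta -> c \in choices delta ->
  exists2 T : filling tau (size delta), ICRHT sigma T & has_content sigma T c.
Proof.
move=> hd /choicesP[sz ch].
pose W := content_rows sigma delta c.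
have WE k : [seq x.1 | x <- W k] = restr tau k by exact: content_rows_lengths.
have sW k : size (W k) = size (restr tau k) by rewrite -WE size_map.
have lenE k r : (r < size (W k))%N -> (nth (0, 0)%N (W k) r).1 = rowlen tau k r.
  by move=> h; rewrite /rowlen -WE (nth_map (0, 0)%N).
pose T : filling tau (size delta) :=
  [ffun x => inord (nth (0, 0)%N (W (ccomp x)) (crow x)).2].
have TE x : T x = (nth (0, 0)%N (W (ccomp x)) (crow x)).2 :> nat.
  rewrite ffunE inordK //; apply: (@content_rows_labels sigma delta c (ccomp x)).
  by rewrite mem_nth // sW cell_crow.
have T1 : row_constant T by move=> x y h1 h2; rewrite !ffunE h1 h2.
have TW k : labelled_rows T k = W k.
  apply: (@eq_from_nth _ (0, 0)%N); rewrite size_labelled_rows // => r rk.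
  have rW : (r < size (W k))%N by rewrite sW.
  rewrite nth_labelled_rows // [RHS]surjective_pairing lenE //; congr (_, _).
  by have [x [xk xr _ ->]] := row_label_cell T rk; rewrite TE xk xr.
have hc : has_content sigma T c.
  move=> i k id; rewrite filled_rowsE // TW; apply/allP => l _; apply/eqP.
  rewrite -count_content_rows // count_map count_filter; apply: eq_count => -[a b] /=.
  by rewrite xpair_eqE.
exists T => //; split=> //.
- by move=> k; apply: (hc 0%N).
- move=> i id; exists (nth empty_type c i); apply/is_rhoE.
  by split=> [|k]; [apply: ch | apply: (hc i.+1 k)].
move=> x y xy _ _; rewrite !TE -!lenE ?sW ?cell_crow // xy => ll le.
have := sorted_leq_nth row_ge_trans row_ge_refl (0, 0)%N
  (content_rows_sorted sigma delta c (ccomp y)) (crow x) (crow y).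
rewrite !inE -/W sW -{1}xy !cell_crow => /(_ isT isT le).
by rewrite /row_ge ll ltnn eqxx.
Qed.

(** * Summation over tableaux *)

(** Sending a tableau to its tuple of types preserves weights; it is injective by
    [tableau_types_inj] and onto by [tableau_exists]. *)
Lemma ICRHT_weight_sum (tau : btype) sigma delta : all is_block delta ->
  \sum_(T : filling tau (size delta) | `[< ICRHT sigma T >]) wt T =
  \sum_(c <- choices delta | combine sigma delta c == tau) choice_weight c.
Proof.
move=> hd; under eq_bigr do rewrite wtE.
rewrite -big_filter -(big_map (@tableau_types tau delta) xpredT).
rewrite -[RHS]big_filter; apply/perm_big/uniq_perm.
- rewrite map_inj_in_uniq ?filter_uniq ?index_enum_uniq // => T T'.
  by rewrite !mem_filter => /andP[/asboolP hT _] /andP[/asboolP hT' _]; apply: tableau_types_inj hd hT hT'.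
- by rewrite filter_uniq ?choices_uniq.
move=> c; rewrite mem_filter; apply/mapP/andP => [[T + ->]|[/eqP + cd]].
  rewrite mem_filter => /andP[/asboolP hT _].
  have [cd hc] := tableau_types_content hT; split=> //.
  by case: hT => T1 _ _ _; rewrite (has_content_shape hd _ T1 hc) // size_mkseq.
move=> <-; have [T hT hc] := tableau_exists sigma hd cd.
exists T; last by rewrite (tableau_types_uniq hd cd hc).
by rewrite mem_filter mem_index_enum andbT; apply/asboolP.
Qed.

Theorem theorem44 (sigma : btype) (delta : seq (nat * nat))
    (hdelta : all is_block delta) :
  ptensor sigma * Hprod delta =
  \sum_(tau \in [set: btype])
    (\sum_(T : filling tau (size delta) | `[< ICRHT sigma T >]) wt T)
      *: ptensor tau.
Proof.
rewrite psum_product_expansion //.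
pose L := undup [seq combine sigma delta c | c <- choices delta].
have memL c : c \in choices delta -> combine sigma delta c \in L.
  by move=> cd; rewrite mem_undup map_f.
(* a type outside [L] is the shape of no tuple of types *)
rewrite (fsbigE L _ (undup_uniq _)) //; last first.
  move=> tau _ tauL; rewrite ICRHT_weight_sum // big_seq_cond big1 ?scale0r // => c.
  by move=> /andP[/memL + /eqP E]; rewrite E (negbTE tauL).
under [RHS]eq_bigr do rewrite ICRHT_weight_sum // scaler_suml.
rewrite (eq_bigl xpredT) => [|tau]; last by rewrite in_setT.
rewrite (exchange_big_dep xpredT) //= big_seq [RHS]big_seq.
apply: eq_bigr => c /memL cL.
rewrite (eq_bigl (fun tau => tau == combine sigma delta c)) => [|tau]; last by rewrite eq_sym.
by rewrite big_pred1_uniq ?undup_uniq.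
Qed.
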